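(* Fix $\alpha \in (1/2, 1)$ and $\varepsilon>0$. Then there exists $n_0$ such that the following holds for all $n>n_0$: every $n$-vertex graph $G$ with at least $\lfloor n^2/4\rfloor+1$ edges and $b(G)<\alpha n/2$ satisfies $$t(G) > (\alpha(1-\alpha)-\varepsilon) \frac{n^2}{4}.$$
   Context: Graphs are finite and simple. A book of size $b$ in a graph is an edge that lies in $b$ triangles; $b(G)$ denotes the maximum size of a book in $G$, i.e. the maximum, over all edges $e$ of $G$, of the number of triangles of $G$ containing $e$. $t(G)$ denotes the number of triangles in $G$. *)

(* Defs.v *)
From mathcomp Require Import all_boot all_order all_algebra.
From mathcomp Require Import reals.
Set Implicit Arguments. Unset Strict Implicit. Unset Printing Implicit Defensive.

Definition simple_graph (n : nat) (e : rel 'I_n) : Prop :=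
  (forall x y, e x y = e y x) /\ (forall x, ~~ e x x).

Definition num_edges (n : nat) (e : rel 'I_n) : nat :=
  #|[set p : 'I_n * 'I_n | (p.1 < p.2)%N && e p.1 p.2]|.

Definition num_triangles (n : nat) (e : rel 'I_n) : nat :=
  #|[set p : 'I_n * 'I_n * 'I_n |
       [&& (p.1.1 < p.1.2)%N, (p.1.2 < p.2)%N,
           e p.1.1 p.1.2, e p.1.2 p.2 & e p.1.1 p.2]]|.

(* number of triangles containing the edge xy (= common neighbours) *)
Definition book_size (n : nat) (e : rel 'I_n) (x y : 'I_n) : nat :=
  #|[set z : 'I_n | e x z && e y z]|.

(* b(G): maximum book size over all edges (0 if no edges) *)
Definition max_book (n : nat) (e : rel 'I_n) : nat :=
  \max_(p : 'I_n * 'I_n | e p.1 p.2) book_size e p.1 p.2.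

(* Main.v *)
Require Import Defs.
From mathcomp Require Import all_boot all_order all_algebra.
From mathcomp Require Import reals.
From mathcomp Require Import zify ring lra.
Set Implicit Arguments. Unset Strict Implicit. Unset Printing Implicit Defensive.
Import Order.TTheory GRing.Theory Num.Theory.
Local Open Scope ring_scope.

(** Since [d(u) + d(v) <= n + codeg(u, v)] on every edge, a graph with more than
    [n^2/4] edges and [O(n^2)] triangles has degrees with variance [O(n)], and
    the neighbourhood of a typical vertex is one side of a cut with [o(n^2)]
    edges inside its sides; this replaces the triangle removal lemma.  In a
    maximum cut there are more "bad" pairs (edges inside a side) than missing
    pairs across.  The book bound forces every bad edge to have an endpoint with
    linearly many missing pairs, and there are only [o(n)] such vertices, so one
    of them, [x], has at least [m - o(n)] bad edges to other vertices, where [m]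
    counts its missing pairs.  The book bound and the maximality of the cut
    confine [m] to [(1 - alpha) n/2 - o(n) <= m <= n/4 + o(n)], and the triangles
    made of a bad edge at [x] and a vertex across already number about
    [m (n/2 - m) >= alpha (1 - alpha) n^2/4 - o(n^2)].

    Edges, bad pairs and missing pairs are counted as ordered pairs. *)

(** * Averaging and a numerical estimate *)

Lemma exists_lt_of_sum_lt (R : realFieldType) (I : finType) (f g : I -> R) :
  \sum_i f i < \sum_i g i -> exists i, f i < g i.
Proof.
move=> fg; apply/existsP; apply: contraLR fg.
rewrite negb_exists => /forallP gf; rewrite -leNgt.
by apply: ler_sum => i _; rewrite leNgt.
Qed.

Lemma sum_indicator_mul (R : realFieldType) (I : finType) (x : I) (f : I -> R) :
  \sum_i (i == x)%:R * f i = f x.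
Proof.
rewrite (bigD1 x) //= eqxx mul1r big1 ?addr0 // => i /negPf ->.
by rewrite mul0r.
Qed.

(* With [a = (1 - alpha) / 2], the product [mu * (1/2 - mu)] is smallest at the
   left end [mu = a] of the range, where it equals [alpha * (1 - alpha) / 4]. *)
Lemma page_density_lower (R : realFieldType) (alpha gamma mu : R) :
  1 / 2 < alpha -> alpha < 1 -> 0 < gamma -> 9 * gamma <= 2 * (1 - alpha) ->
  (1 - alpha) / 2 - 5 / 4 * gamma < mu -> mu < 1 / 4 + 5 / 16 * gamma ->
  alpha * (1 - alpha) / 4 - 10 * gamma <
    (mu - 3 / 8 * gamma) * (1 / 2 - 5 / 4 * gamma - mu).
Proof.
move=> ha1 ha2 g0 hg hL hU.
pose a := (1 - alpha) / 2; pose L := a - 5 / 4 * gamma.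
have conc : 0 <= (mu - L) * (1 / 2 - L - mu).
  by apply: mulr_ge0; rewrite /L /a; lra.
have h1 : 0 <= gamma * (1 - mu) by apply: mulr_ge0; lra.
have h2 : 0 <= gamma * (1 - alpha) by apply: mulr_ge0; lra.
have h3 : 0 <= gamma * (1 - gamma) by apply: mulr_ge0; lra.
have h4 : 0 <= gamma * gamma by apply: mulr_ge0; lra.
move: conc; rewrite /L /a; lra.
Qed.

(** * Degrees and cuts of a graph *)

Section Cuts.
Context {R : realFieldType} {T : finType}.
Variable e : rel T.
Hypothesis e_sym : forall x y, e x y = e y x.
Hypothesis e_irr : forall x, ~~ e x x.

Let n : R := #|T|%:R.

Definition degree (u : T) : R := \sum_v (e u v)%:R.

Definition ordered_triangles : R :=
  \sum_u \sum_v \sum_w [&& e u v, e v w & e u w]%:R.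

Definition same_side (S : {set T}) (u v : T) : bool := (u \in S) == (v \in S).

Definition bad (S : {set T}) (u : T) : R :=
  \sum_v (e u v && same_side S u v)%:R.

Definition cross (S : {set T}) (u : T) : R :=
  \sum_v (e u v && ~~ same_side S u v)%:R.

Definition missing (S : {set T}) (u : T) : R :=
  \sum_v (~~ e u v && ~~ same_side S u v)%:R.

Definition opposite (S : {set T}) (u : T) : R :=
  \sum_v (~~ same_side S u v)%:R.

Definition bad_pages (S : {set T}) (x : T) : R :=
  \sum_v \sum_w [&& e x v, same_side S x v, ~~ same_side S x w, e x w & e v w]%:R.

Lemma same_side_sym S u v : same_side S u v = same_side S v u.
Proof. by rewrite /same_side eq_sym. Qed.

Lemma sum_const1 : \sum_(u : T) (1 : R) = n.
Proof. by rewrite sumr_const. Qed.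

Lemma degreeE S u : degree u = bad S u + cross S u.
Proof.
rewrite /degree /bad /cross -big_split; apply: eq_bigr => v _ /=.
by case: (e u v); case: (same_side S u v) => /=; lra.
Qed.

Lemma oppositeE S u : opposite S u = cross S u + missing S u.
Proof.
rewrite /opposite /missing /cross -big_split; apply: eq_bigr => v _ /=.
by case: (e u v); case: (same_side S u v) => /=; lra.
Qed.

(** * From few triangles to a cut with few bad pairs *)

(** For an edge [uv] and any [w], [[uw] + [vw] <= 1 + [uvw is a triangle]]; sum over [w] and over
    ordered edges. *)
Lemma sum_degree_sq :
  2 * \sum_u degree u ^+ 2 <= n * \sum_u degree u + ordered_triangles.
Proof.
have -> : 2 * \sum_u degree u ^+ 2 =
    \sum_u \sum_v \sum_w (e u v)%:R * ((e u w)%:R + (e v w)%:R).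
  rewrite mulr_sumr.
  have -> : \sum_u \sum_v \sum_w (e u v)%:R * ((e u w)%:R + (e v w)%:R : R) =
      \sum_u degree u ^+ 2 + \sum_u \sum_v (e u v)%:R * degree v.
    rewrite -big_split; apply: eq_bigr => u _ /=.
    rewrite expr2 {1}/degree mulr_suml -big_split; apply: eq_bigr => v _ /=.
    rewrite -mulrDr -mulr_sumr big_split //.
  have -> : \sum_u \sum_v (e u v)%:R * degree v = \sum_u degree u ^+ 2.
    rewrite exchange_big; apply: eq_bigr => v _ /=.
    rewrite -mulr_suml expr2; congr (_ * _).
    by apply: eq_bigr => u _; rewrite e_sym.
  by rewrite -big_split; apply: eq_bigr => u _ /=; lra.
have -> : n * \sum_u degree u = \sum_u \sum_v \sum_(w : T) (e u v)%:R.
  rewrite mulr_sumr; apply: eq_bigr => u _; rewrite mulr_sumr.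
  by apply: eq_bigr => v _; rewrite sumr_const mulr_natl.
rewrite /ordered_triangles -big_split; apply: ler_sum => u _ /=.
rewrite -big_split; apply: ler_sum => v _ /=.
rewrite -big_split; apply: ler_sum => w _ /=.
by case: (e u v); case: (e u w); case: (e v w) => /=; lra.
Qed.

(** With [D] the degree sum, expanding the square and inserting [sum_degree_sq] leaves
    [ordered_triangles / 2 - (n / 2) * (D - n ^+ 2 / 2)]. *)
Lemma degree_variance :
  n ^+ 2 / 2 <= \sum_u degree u ->
  \sum_u (degree u - n / 2) ^+ 2 <= ordered_triangles / 2.
Proof.
move=> hD; have := sum_degree_sq.
have -> : \sum_u (degree u - n / 2) ^+ 2 =
    \sum_u degree u ^+ 2 - n * (\sum_u degree u) + n ^+ 3 / 4.
  have -> : n ^+ 3 / 4 = \sum_(u : T) (n ^+ 2 / 4).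
    rewrite sumr_const -(mulr_natl (n ^+ 2 / 4)) -/n; lra.
  rewrite mulr_sumr -sumrB -big_split; apply: eq_bigr => u _ /=; lra.
have n0 : 0 <= n by exact: ler0n.
have := ler_wpM2l n0 hD; lra.
Qed.

Lemma sum_abs_deviation (delta : R) :
  0 < delta -> 0 < n -> n ^+ 2 / 2 <= \sum_u degree u ->
  \sum_u `|degree u - n / 2| <=
    delta * n ^+ 2 + ordered_triangles / (8 * delta * n).
Proof.
move=> d0 n0 /degree_variance hV.
have dn0 : 0 < delta * n by apply: mulr_gt0.
(* This weight makes [delta * n + c * y ^+ 2 - y] a multiple of a square. *)
pose c := (4 * (delta * n))^-1.
have c0 : 0 < c by rewrite invr_gt0 mulr_gt0.
have -> : ordered_triangles / (8 * delta * n) = c * (ordered_triangles / 2).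
  by rewrite /c; field; rewrite !gt_eqF.
apply: (@le_trans _ _ (\sum_u (delta * n + c * (degree u - n / 2) ^+ 2))).
  apply: ler_sum => u _; set x := degree u - n / 2.
  rewrite -(real_normK (num_real x)); set y := `|x|.
  have -> : delta * n + c * y ^+ 2 = y + c * (y - 2 * (delta * n)) ^+ 2.
    by rewrite /c; field; rewrite !gt_eqF.
  by rewrite lerDl mulr_ge0 ?sqr_ge0 // ltW.
rewrite big_split /= sumr_const -mulr_sumr; apply: lerD.
  by rewrite -(mulr_natl (delta * n)) -/n expr2; lra.
by rewrite ler_wpM2l // ltW.
Qed.

(* The cut separates the neighbourhood of [v] from the rest, for a [v] that is
   good on average. *)
Lemma exists_sparse_cut :
  0 < n -> n ^+ 2 / 2 <= \sum_u degree u ->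
  exists S, \sum_u bad S u <=
    2 * ordered_triangles / n + \sum_u `|degree u - n / 2|.
Proof.
move=> n0 hD.
pose tau v : R := \sum_u \sum_w [&& e v u, e v w & e u w]%:R.
have tauE : \sum_v tau v = ordered_triangles.
  apply: eq_bigr => v _; apply: eq_bigr => u _; apply: eq_bigr => w _.
  by case: (e v u); case: (e v w); case: (e u w).
(* Averaging over [v]: the terms [n - 2 * degree v] have sum at most 0. The weight [n / 4] is half
   the coefficient [n / 2] that appears below. *)
have [v hv] : exists v, tau v + (n - 2 * degree v) * n / 4 <=
    ordered_triangles / n.
  apply/existsP; apply: contraT; rewrite negb_exists => /forallP h.
  have nT : (0 < #|T|)%N by rewrite -(ltr0n R).
  have [v0 _] : exists v : T, v \in T by apply/card_gt0P.
  have : \sum_(v : T) ordered_triangles / n <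
      \sum_v (tau v + (n - 2 * degree v) * n / 4).
    apply: ltr_sum; first by apply/hasP; exists v0; rewrite ?mem_index_enum.
    by move=> i _; rewrite ltNge.
  rewrite sumr_const -(mulr_natl (_ / n)) -/n mulrCA divff ?gt_eqF // mulr1.
  rewrite big_split /= tauE -!mulr_suml sumrB sumr_const -mulr_sumr.
  rewrite -(mulr_natl n) -/n.
  have := ler_wpM2l (ltW n0) hD; lra.
exists [set u | e v u].
set S := [set u | e v u].
(* With these signs an edge inside the neighbourhood of [v] counts [1 = 2 - 1], one outside it
   [1 = 0 + 1], and one across [0]. *)
pose s u : R := if e v u then -1 else 1.
have -> : \sum_u bad S u = 2 * tau v + \sum_u s u * degree u.
  have -> : \sum_u s u * degree u =
     \sum_u \sum_w ((s u + s w) / 2) * (e u w)%:R.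
    have h1 : \sum_u s u * degree u = \sum_u \sum_w s u * (e u w)%:R.
      by apply: eq_bigr => u _; rewrite mulr_sumr.
    have h2 : \sum_u s u * degree u = \sum_u \sum_w s w * (e u w)%:R.
      rewrite h1 exchange_big; apply: eq_bigr => u _; apply: eq_bigr => w _.
      by rewrite e_sym.
    have -> : \sum_u \sum_w ((s u + s w) / 2) * (e u w)%:R =
        (\sum_u \sum_w s u * (e u w)%:R + \sum_u \sum_w s w * (e u w)%:R) / 2.
      rewrite -big_split mulr_suml; apply: eq_bigr => u _ /=.
      rewrite -big_split mulr_suml; apply: eq_bigr => w _ /=; lra.
    by rewrite -h1 -h2; lra.
  rewrite /tau mulr_sumr -big_split; apply: eq_bigr => u _ /=.
  rewrite mulr_sumr -big_split; apply: eq_bigr => w _ /=.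
  rewrite /same_side /s !inE.
  by case: (e v u); case: (e v w); case: (e u w) => /=; lra.
have -> : \sum_u s u * degree u =
    \sum_u s u * (degree u - n / 2) + (n - 2 * degree v) * n / 2.
  have -> : n - 2 * degree v = \sum_u s u.
    rewrite -sum_const1 /degree mulr_sumr -sumrB; apply: eq_bigr => u _.
    by rewrite /s; case: (e v u) => /=; lra.
  rewrite -mulrA mulr_suml -big_split; apply: eq_bigr => u _ /=; lra.
have : \sum_u s u * (degree u - n / 2) <= \sum_u `|degree u - n / 2|.
  apply: ler_sum => u _; rewrite /s; case: (e v u).
    by rewrite mulN1r -normrN ler_norm.
  by rewrite mul1r ler_norm.
move: hv; rewrite -(mulrA 2 ordered_triangles).
by set q := ordered_triangles / n; lra.
Qed.

(** Take a cut with the fewest bad pairs: moving [x] to the other side exchanges its bad and cross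
    pairs, in both orders. *)
Lemma exists_locally_optimal_cut (c : R) :
  (exists S, \sum_u bad S u <= c) ->
  exists S, \sum_u bad S u <= c /\ forall x, bad S x <= cross S x.
Proof.
case=> S0 hS0.
pose S := [arg min_(S < S0) \sum_u bad S u]%O.
have hS S' : \sum_u bad S u <= \sum_u bad S' u.
  by rewrite /S; case: arg_minP => // i _ /(_ S' isT).
exists S; split=> [|x]; first exact: le_trans (hS S0) hS0.
pose S' := [set u | (u \in S) (+) (u == x)].
have flip : \sum_u bad S' u = \sum_u bad S u + 2 * (cross S x - bad S x).
  pose g v : R := (e x v && ~~ same_side S x v)%:R - (e x v && same_side S x v)%:R.
  have gE : cross S x - bad S x = \sum_v g v by rewrite -sumrB.
  have -> : 2 * (cross S x - bad S x) =
      \sum_u \sum_v ((u == x)%:R * g v + (v == x)%:R * g u).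
    rewrite gE mulr_sumr.
    have h1 : \sum_u \sum_v (u == x)%:R * g v = \sum_v g v.
      by rewrite exchange_big; apply: eq_bigr => v _; rewrite sum_indicator_mul.
    have h2 : \sum_u \sum_v (v == x)%:R * g u = \sum_v g v.
      by apply: eq_bigr => u _; rewrite (sum_indicator_mul x (fun=> g u)).
    under [RHS]eq_bigr do rewrite big_split /=.
    by rewrite big_split /= h1 h2 -big_split; apply: eq_bigr => u _ /=; lra.
  rewrite -big_split; apply: eq_bigr => u _ /=.
  rewrite -big_split; apply: eq_bigr => v _ /=.
  rewrite /g /same_side !inE.
  have [->|ux] := eqVneq u x; have [->|vx] := eqVneq v x.
  - by rewrite (negPf (e_irr x)) /=; lra.
  - by case: (e x v); case: (x \in S); case: (v \in S) => /=; lra.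
  - rewrite (e_sym u x).
    by case: (e x u); case: (x \in S); case: (u \in S) => /=; lra.
  - by rewrite !addbF /=; lra.
have := hS S'; rewrite flip; lra.
Qed.

(** Both triangle terms from the previous bounds are linear in [n], so for large [n] they fit into a
    second [delta * n ^+ 2]. *)
Lemma exists_near_bipartition (delta : R) :
  0 < delta -> 0 < n -> n ^+ 2 / 2 <= \sum_u degree u ->
  ordered_triangles <= 3 / 8 * n ^+ 2 -> 1 + delta^-1 <= delta * n ->
  exists S, \sum_u bad S u <= 2 * delta * n ^+ 2 /\
            forall x, bad S x <= cross S x.
Proof.
move=> d0 n0 hD hT hn; apply: exists_locally_optimal_cut.
have [S hS] := exists_sparse_cut n0 hD; exists S; apply: le_trans hS _.
have hdev := sum_abs_deviation d0 n0 hD.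
have h1 : 2 * ordered_triangles / n <= n.
  rewrite ler_pdivrMr //; have := sqr_ge0 n; lra.
have h2 : ordered_triangles / (8 * delta * n) <= delta^-1 * n.
  have dn0 : 0 < 8 * delta * n by rewrite !mulr_gt0.
  rewrite ler_pdivrMr //.
  have -> : delta^-1 * n * (8 * delta * n) = 8 * n ^+ 2.
    by field; rewrite gt_eqF.
  have := sqr_ge0 n; lra.
have := ler_wpM2r (ltW n0) hn; lra.
Qed.

(** * Balance of the cut; missing against bad pairs *)

Lemma sum_opposite (S : {set T}) :
  let k := \sum_v (v \in S)%:R in
  (forall u, opposite S u = if u \in S then n - k else k) /\
  \sum_u opposite S u = 2 * k * (n - k).
Proof.
move=> k.
have oppE v : opposite S v = if v \in S then n - k else k.
  rewrite /opposite /k /same_side -sum_const1; case: (v \in S).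
    by rewrite -sumrB; apply: eq_bigr => w _; case: (w \in S) => /=; lra.
  by apply: eq_bigr => w _; case: (w \in S).
split=> //; have -> : 2 * k * (n - k) =
    \sum_v ((v \in S)%:R * (n - k) + (1 - (v \in S)%:R) * k).
  by rewrite big_split /= -!mulr_suml sumrB sum_const1 -/k; lra.
by apply: eq_bigr => v _; rewrite oppE; case: (v \in S) => /=; lra.
Qed.

Lemma sum_opposite_le (S : {set T}) : \sum_u opposite S u <= n ^+ 2 / 2.
Proof.
have [_ ->] := sum_opposite S; set k := \sum_v _.
have := sqr_ge0 (k - n / 2); lra.
Qed.

(** With [k] the size of [S], the pairs across number [n^2/2 - 2 (k - n/2)^2] and include every edge
    that is not bad, so [2 (k - n/2)^2 <= eta^2 n^2]. *)
Lemma opposite_near_half (S : {set T}) (eta : R) u :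
  0 <= eta -> n ^+ 2 / 2 <= \sum_u degree u ->
  \sum_u bad S u <= eta ^+ 2 * n ^+ 2 ->
  n / 2 - eta * n <= opposite S u <= n / 2 + eta * n.
Proof.
move=> eta0 hD hB; have [oppE sum_opp] := sum_opposite S.
set k := \sum_v _ in oppE sum_opp.
have le_opp : \sum_v degree v - \sum_v bad S v <= \sum_v opposite S v.
  rewrite -sumrB; apply: ler_sum => v _.
  rewrite (degreeE S) oppositeE addrAC subrr add0r lerDl.
  by apply: sumr_ge0 => w _.
have sqk : (k - n / 2) ^+ 2 <= (eta * n) ^+ 2.
  have := sqr_ge0 (eta * n); rewrite exprMn.
  move: hB; set z := _ * _ ^+ 2; lra.
have n0 : 0 <= n by exact: ler0n.
have : `|k - n / 2| <= eta * n.
  by rewrite -(@ler_pXn2r _ 2) ?nnegrE ?mulr_ge0 // real_normK ?num_real.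
rewrite ler_norml oppE => /andP[? ?]; apply/andP.
by case: (u \in S); split; lra.
Qed.

(** There are fewer pairs across than ordered edges; removing the cross edges from both leaves the
    missing and the bad pairs. *)
Lemma sum_missing_lt_sum_bad (S : {set T}) :
  n ^+ 2 / 2 < \sum_u degree u -> \sum_u missing S u < \sum_u bad S u.
Proof.
move=> hD; have := sum_opposite_le S.
have -> : \sum_u opposite S u =
    \sum_u degree u - \sum_u bad S u + \sum_u missing S u.
  rewrite -sumrB -big_split; apply: eq_bigr => u _ /=.
  by rewrite (degreeE S) oppositeE; lra.
lra.
Qed.

(** * A vertex with many bad pages *)

Lemma common_opposite (S : {set T}) u v :
  same_side S u v ->
  opposite S u - missing S u - missing S v <=
    \sum_w [&& ~~ same_side S u w, e u w & e v w]%:R.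
Proof.
move=> suv; rewrite -!sumrB; apply: ler_sum => w _.
have -> : same_side S v w = same_side S u w.
  by rewrite /same_side (eqP suv).
by case: (same_side S u w); case: (e u w); case: (e v w) => /=; lra.
Qed.

(* [H] is a small set of vertices meeting every bad edge, so up to [#|H|]
   per vertex the global inequality between missing and bad pairs localises to
   a vertex of [H]. *)
Lemma exists_missing_lt_bad (S : {set T}) (H : pred T) (h : R) :
  h = \sum_u (H u)%:R ->
  (forall u v, e u v -> same_side S u v -> H u || H v) ->
  \sum_u missing S u < \sum_u bad S u ->
  exists2 x, H x & missing S x <
    \sum_v [&& e x v, same_side S x v & ~~ H v]%:R + 3 / 2 * h.
Proof.
move=> hE cover hlt.
pose b' x : R := \sum_v [&& e x v, same_side S x v & ~~ H v]%:R.
(* A bad pair leaving [H] is counted from its end in [H]; pairs inside [H] number at most [h^2]. *)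
have h_bad : \sum_u bad S u <= \sum_u (H u)%:R * (2 * b' u + h).
  have -> : \sum_u (H u)%:R * (2 * b' u + h) = \sum_u \sum_v
      ((H u)%:R * [&& e u v, same_side S u v & ~~ H v]%:R
     + (H v)%:R * [&& e v u, same_side S v u & ~~ H u]%:R
     + (H u)%:R * (H v)%:R).
    have h1 : \sum_u (H u)%:R * b' u = \sum_u \sum_v
        (H u)%:R * [&& e u v, same_side S u v & ~~ H v]%:R.
      by apply: eq_bigr => u _; rewrite mulr_sumr.
    have h2 := h1; rewrite exchange_big /= in h2.
    under [RHS]eq_bigr do rewrite !big_split /=.
    rewrite !big_split /= -h1 -h2 -big_split -big_split; apply: eq_bigr => u _ /=.
    by rewrite -mulr_sumr -hE; lra.
  apply: ler_sum => u _; apply: ler_sum => v _.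
  rewrite (e_sym v u) (same_side_sym S v u).
  have := cover u v; case: (e u v); case: (same_side S u v);
    case: (H u); case: (H v) => /= hc; first [lra | by have := hc isT isT].
(* Counting from both ends doubles the pairs inside [H]; the [- h] takes 2 off each of these. *)
have h_miss : \sum_u (H u)%:R * (2 * (missing S u - h)) <= \sum_u missing S u.
  have -> : \sum_u (H u)%:R * (2 * (missing S u - h)) = \sum_u \sum_v
      ((H u)%:R * ((~~ e u v && ~~ same_side S u v)%:R - (H v)%:R)
     + (H v)%:R * ((~~ e v u && ~~ same_side S v u)%:R - (H u)%:R)).
    have h1 : \sum_u (H u)%:R * (missing S u - h) = \sum_u \sum_v
        (H u)%:R * ((~~ e u v && ~~ same_side S u v)%:R - (H v)%:R).
      by apply: eq_bigr => u _; rewrite hE -sumrB mulr_sumr.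
    have h2 := h1; rewrite exchange_big /= in h2.
    under [RHS]eq_bigr do rewrite !big_split /=.
    rewrite big_split /= -h1 -h2 -big_split; apply: eq_bigr => u _ /=; lra.
  apply: ler_sum => u _; apply: ler_sum => v _.
  rewrite (e_sym v u) (same_side_sym S v u).
  case: (e u v); case: (same_side S u v); case: (H u); case: (H v) => /=; lra.
have [x] := exists_lt_of_sum_lt
  (le_lt_trans h_miss (lt_le_trans hlt h_bad)).
case Hx: (H x) => /=; last lra.
by move=> hx; exists x => //; rewrite -/(b' x); lra.
Qed.

(** Apply [common_opposite] to each bad edge from [x] to a vertex outside [H]. *)
Lemma bad_pages_lower (S : {set T}) (H : pred T) (g : R) x :
  (forall v, ~~ H v -> missing S v <= g) ->
  (\sum_v [&& e x v, same_side S x v & ~~ H v]%:R) *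
    (opposite S x - missing S x - g) <= bad_pages S x.
Proof.
move=> hg; rewrite mulr_suml; apply: ler_sum => v _.
have nneg : 0 <= \sum_w [&& e x v, same_side S x v, ~~ same_side S x w,
                          e x w & e v w]%:R :> R.
  by apply: sumr_ge0 => w _.
case exv: (e x v) nneg => /=; last by rewrite mul0r.
case sxv: (same_side S x v) => /=; last by rewrite mul0r.
case Hv: (H v) => /= nneg; first by rewrite mul0r.
have := common_opposite sxv; have := hg v; rewrite Hv => /(_ isT).
lra.
Qed.

Lemma exists_many_bad_pages (S : {set T}) (alpha gamma : R) :
  1 / 2 < alpha -> alpha < 1 -> 0 < gamma -> 9 * gamma <= 2 * (1 - alpha) ->
  0 < n -> n ^+ 2 / 2 < \sum_u degree u ->
  \sum_u bad S u <= (gamma / 4) ^+ 2 * n ^+ 2 ->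
  (forall x, bad S x <= cross S x) ->
  (forall u v, e u v -> \sum_w (e u w && e v w)%:R < alpha * n / 2) ->
  exists x, (alpha * (1 - alpha) / 4 - 10 * gamma) * n ^+ 2 < bad_pages S x.
Proof.
move=> ha1 ha2 g0 hg n0 hD hB opt book.
have opp_bounds u := @opposite_near_half S (gamma / 4) u
  (ltW (divr_gt0 g0 (ltr0n _ 4))) (ltW hD) hB.
have gn0 : 0 < gamma * n by apply: mulr_gt0.
have miss_edge u v : e u v -> same_side S u v ->
    (1 - alpha) / 2 * n - gamma / 4 * n < missing S u + missing S v.
  move=> euv suv; have := common_opposite suv; have := book _ _ euv.
  have : \sum_w [&& ~~ same_side S u w, e u w & e v w]%:R <=
         \sum_w (e u w && e v w)%:R :> R.
    apply: ler_sum => w _.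
    by case: (same_side S u w); case: (e u w); case: (e v w).
  have /andP[] := opp_bounds u; lra.
pose H u := gamma * n <= missing S u.
pose h : R := \sum_u (H u)%:R.
(* As [(1 - alpha) / 2 >= 9 / 4 * gamma], the two missing counts add up to more than
   [2 * gamma * n]. *)
have cover u v : e u v -> same_side S u v -> H u || H v.
  move=> euv suv; have := miss_edge _ _ euv suv.
  have := ler_wpM2r (ltW n0) hg.
  by rewrite /H; do 2 case: lerP => //=; lra.
have lt_mb := sum_missing_lt_sum_bad S hD.
have [x Hx hx] := exists_missing_lt_bad (erefl h) cover lt_mb.
set b' := \sum_v _ in hx.
have h_small : h <= gamma / 16 * n.
  rewrite -(ler_pM2l gn0); have : gamma * n * h <= \sum_u missing S u.
    rewrite mulr_sumr; apply: ler_sum => u _.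
    case Hu: (H u); first by rewrite mulr1.
    by rewrite mulr0; apply: sumr_ge0.
  move: lt_mb hB; lra.
have b'_gt : missing S x - 3 / 8 * gamma * n < b' by lra.
(* [b'] is positive because [missing S x >= gamma * n]. As [v] has fewer than [gamma * n] missing
   pairs, [miss_edge] then bounds [missing S x] from below. *)
have [v /and3P[exv sxv Hv]] : exists v, [&& e x v, same_side S x v & ~~ H v].
  apply/existsP; apply: contraLR b'_gt; rewrite negb_exists => /forallP none.
  rewrite /b' big1 => [|w _]; last by rewrite (negPf (none w)).
  move: Hx; rewrite /H; lra.
have b'_le : b' <= bad S x.
  apply: ler_sum => w _.
  by case: (e x w); case: (same_side S x w); case: (H w).
have missL := miss_edge _ _ exv sxv.
have := bad_pages_lower x (fun v (Hv : ~~ H v) => ltW (etrans (ltNge _ _) Hv)).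
rewrite -/b'.
have /andP[opp1 opp2] := opp_bounds x.
have := opt x; have := oppositeE S x.
move: Hv Hx; rewrite /H -ltNge => Hv Hx oppE bc.
(* Local optimality: [b' <= bad S x <= cross S x = opposite S x - missing S x]. *)
have missU : missing S x < n / 4 + 5 / 16 * gamma * n by lra.
pose mu := missing S x / n.
have muE : missing S x = mu * n by rewrite /mu divfK ?gt_eqF.
have mu1 : (1 - alpha) / 2 - 5 / 4 * gamma < mu.
  by rewrite -(ltr_pM2r n0) -muE; lra.
have mu2 : mu < 1 / 4 + 5 / 16 * gamma.
  by rewrite -(ltr_pM2r n0) -muE; lra.
have dens := page_density_lower ha1 ha2 g0 hg mu1 mu2.
move=> pages; exists x; apply: lt_le_trans pages.
have n2 : 0 < n ^+ 2 by apply: exprn_gt0.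
move: dens; rewrite -(ltr_pM2r n2) => /lt_le_trans; apply.
(* The loss [5 / 4 * gamma] is [gamma / 4] from the imbalance of the cut and [gamma] from vertices
   outside [H]. *)
have c0 : 0 <= n / 2 - 5 / 4 * gamma * n - missing S x.
  have := ler_wpM2r (ltW n0) hg; have := ltr_pM2r n0; move=> /(_ _ _) lt2.
  have : (1 / 2) * n < alpha * n by rewrite lt2.
  lra.
apply: (@le_trans _ _ (b' * (n / 2 - 5 / 4 * gamma * n - missing S x))).
  have := ler_wpM2r c0 (ltW b'_gt); rewrite muE; lra.
apply: ler_wpM2l; first by apply: sumr_ge0.
lra.
Qed.

End Cuts.

(** * From ordered sums to the counts of edges and triangles *)

Section Counting.
Context {R : realFieldType} {n : nat}.
Variable e : rel 'I_n.
Hypothesis e_sym : forall x y, e x y = e y x.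
Hypothesis e_irr : forall x, ~~ e x x.

Lemma natr_card_pred (I : finType) (P : pred I) :
  #|[set i | P i]|%:R = \sum_i (P i)%:R :> R.
Proof.
rewrite -sum1_card natr_sum big_mkcond; apply: eq_bigr => i _ /=.
by rewrite inE; case: (P i).
Qed.

Lemma adj_neq u v : e u v -> u != v :> nat.
Proof. by apply: contraTneq => /val_inj ->; exact: e_irr. Qed.

Lemma num_trianglesE :
  (num_triangles e)%:R =
  \sum_(u < n) \sum_(v < n) \sum_(w < n)
    [&& (u < v)%N, (v < w)%N, e u v, e v w & e u w]%:R :> R.
Proof. by rewrite pair_bigA pair_bigA natr_card_pred. Qed.

Lemma sum_degreeE : \sum_u degree e u = 2 * (num_edges e)%:R :> R.
Proof.
pose F (u v : 'I_n) : R := ((u < v)%N && e u v)%:R.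
have h : (num_edges e)%:R = \sum_u \sum_v F u v.
  by rewrite pair_bigA natr_card_pred.
have -> : 2 * (num_edges e)%:R = \sum_u \sum_v (F u v + F v u).
  have h' := h; rewrite exchange_big /= in h'.
  under [RHS]eq_bigr do rewrite big_split /=.
  by rewrite big_split /= -h -h'; lra.
apply: eq_bigr => u _; apply: eq_bigr => v _; rewrite /F (e_sym v u).
case: ltngtP => [| |/val_inj ->] /=; first by lra.
  by lra.
by rewrite (negPf (e_irr v)) /=; lra.
Qed.

(** Each ordered triangle is increasing under one of the six permutations of its variables. *)
Lemma ordered_triangles_le : ordered_triangles e <= 6 * (num_triangles e)%:R :> R.
Proof.
pose F (u v w : 'I_n) : R := [&& (u < v)%N, (v < w)%N, e u v, e v w & e u w]%:R.
have t1 : (num_triangles e)%:R = \sum_u \sum_v \sum_w F u v w.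
  exact: num_trianglesE.
have t2 : (num_triangles e)%:R = \sum_u \sum_v \sum_w F u w v.
  by rewrite t1; apply: eq_bigr => u _; rewrite exchange_big.
have t3 : (num_triangles e)%:R = \sum_u \sum_v \sum_w F v u w.
  by rewrite t1 exchange_big.
have t4 : (num_triangles e)%:R = \sum_u \sum_v \sum_w F w u v.
  by rewrite t3; apply: eq_bigr => u _; rewrite exchange_big.
have t5 : (num_triangles e)%:R = \sum_u \sum_v \sum_w F v w u.
  by rewrite t2 exchange_big.
have t6 : (num_triangles e)%:R = \sum_u \sum_v \sum_w F w v u.
  by rewrite t5; apply: eq_bigr => u _; rewrite exchange_big.
have -> : 6 * (num_triangles e)%:R = \sum_u \sum_v \sum_w
    (F u v w + F u w v + F v u w + F w u v + F v w u + F w v u).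
  under [RHS]eq_bigr => u _.
    under eq_bigr do rewrite !big_split /=.
    rewrite !big_split /=; over.
  by rewrite !big_split /= -t1 -t2 -t3 -t4 -t5 -t6; lra.
apply: ler_sum => u _; apply: ler_sum => v _; apply: ler_sum => w _.
case uvw: [&& e u v, e v w & e u w]; last by rewrite !addr_ge0 ?ler0n.
have /and3P[uv vw uw] := uvw.
rewrite /F (e_sym w v) (e_sym v u) (e_sym w u) uv vw uw !andbT.
have := adj_neq uv; have := adj_neq vw; have := adj_neq uw.
case: (ltngtP u v) => uv'; case: (ltngtP v w) => vw' //;
  case: (ltngtP u w) => uw' // _ _ _ /=; first [lra | lia].
Qed.

(** A triangle through [x] arises from only one pair: its bad neighbour lies on the side of [x], its
    third vertex on the other. Sorting the triple is thus injective. *)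
Lemma bad_pages_le (S : {set 'I_n}) x :
  bad_pages e S x <= (num_triangles e)%:R :> R.
Proof.
pose P (p : 'I_n * 'I_n) := [&& e x p.1, same_side S x p.1,
  ~~ same_side S x p.2, e x p.2 & e p.1 p.2].
have -> : bad_pages e S x = #|[set p | P p]|%:R :> R.
  by rewrite natr_card_pred /bad_pages pair_bigA.
pose sort3 (p : 'I_n * 'I_n) : 'I_n * 'I_n * 'I_n :=
  let: (y, z) := p in
  if (x < y)%N then
    if (y < z)%N then (x, y, z) else if (x < z)%N then (x, z, y) else (z, x, y)
  else
    if (x < z)%N then (y, x, z) else if (y < z)%N then (y, z, x) else (z, y, x).
have sort3_inj : {in [set p | P p] &, injective sort3}.
  move=> [y z] [y' z']; rewrite !inE /P /same_side /=.
  move=> /and5P[xy /eqP sy sz xz yz] /and5P[xy' /eqP sy' sz' xz' yz'].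
  have dx (a : 'I_n) : e x a -> x <> a by move=> + xa; rewrite -xa (negPf (e_irr x)).
  move: (dx _ xy) (dx _ xz) (dx _ xy') (dx _ xz') => ? ? ? ?.
  have nyz' : y <> z' by move=> E; move: sz'; rewrite -E sy eqxx.
  have ny'z : y' <> z by move=> E; move: sz; rewrite -E sy' eqxx.
  by rewrite /sort3; repeat (case: ifP => _); case=> *; congruence.
rewrite ler_nat -(card_in_imset sort3_inj) subset_leq_card //.
apply/subsetP => q /imsetP[[y z]]; rewrite inE /P /same_side /=.
move=> /and5P[xy /eqP sy sz xz yz] ->; rewrite inE.
have := adj_neq xy; have := adj_neq xz; have := adj_neq yz.
rewrite /sort3 => ? ? ?; repeat (case: ifP => ?) => /=.
all: rewrite ?(e_sym z y) ?(e_sym y x) ?(e_sym z x) xy xz yz !andbT.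
all: by apply/andP; split; lia.
Qed.

End Counting.

Theorem theorem1 (R : realType) (alpha eps : R) :
  1 / 2 < alpha -> alpha < 1 -> 0 < eps ->
  exists n0 : nat, forall (n : nat) (e : rel 'I_n),
    (n0 < n)%N ->
    simple_graph e ->
    ((n ^ 2) %/ 4 + 1 <= num_edges e)%N ->
    (max_book e)%:R < alpha * n%:R / 2 ->
    (alpha * (1 - alpha) - eps) * (n%:R ^+ 2) / 4 < (num_triangles e)%:R.
Proof.
move=> ha1 ha2 eps0.
(* The loss [10 * gamma * n^2] must stay within [eps * n^2 / 4]; the other bound is the one that
   [cover] uses. *)
pose gamma := Num.min (eps / 40) (2 * (1 - alpha) / 9).
have g0 : 0 < gamma by rewrite lt_min; apply/andP; split; lra.
have g_eps : 40 * gamma <= eps.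
  have : gamma <= eps / 40 by rewrite ge_min lexx.
  lra.
have g_alpha : 9 * gamma <= 2 * (1 - alpha).
  have : gamma <= 2 * (1 - alpha) / 9 by rewrite ge_min lexx orbT.
  lra.
pose delta := (gamma / 4) ^+ 2 / 2.
have d0 : 0 < delta by rewrite divr_gt0 // exprn_gt0 // divr_gt0.
exists (Num.truncn ((1 + delta^-1) / delta)) => n e ltn [e_sym e_irr] hm hb.
have hn : 1 + delta^-1 <= delta * n%:R.
  rewrite mulrC -ler_pdivrMr //; apply: ltW; apply: lt_le_trans (truncnS_gt _) _.
  by rewrite ler_nat.
have n0 : 0 < n%:R :> R by rewrite ltr0n; apply: leq_ltn_trans ltn.
rewrite ltNge; apply/negP => ht.
have n2 : 0 <= n%:R ^+ 2 :> R by exact: sqr_ge0.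
have hD : #|'I_n|%:R ^+ 2 / 2 < \sum_u degree e u :> R.
  rewrite card_ord sum_degreeE //.
  have : (n ^ 2 < 4 * num_edges e)%N by lia.
  rewrite -(ltr_nat R) natrM natrX; lra.
have hT : ordered_triangles e <= 3 / 8 * #|'I_n|%:R ^+ 2 :> R.
  apply: le_trans (ordered_triangles_le e_sym e_irr) _; rewrite card_ord.
  (* Since [alpha * (1 - alpha) <= 1 / 4], there are at most [n^2 / 16] triangles, hence at most
     [6 / 16 * n^2] ordered ones. *)
  have : (alpha * (1 - alpha) - eps) * n%:R ^+ 2 <= 1 / 4 * n%:R ^+ 2.
    by apply: ler_wpM2r => //; have := sqr_ge0 (alpha - 1 / 2); lra.
  move: ht; lra.
have hcard : #|'I_n|%:R = n%:R :> R by rewrite card_ord.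
rewrite -hcard in n0 hn hb.
have [S [hS opt]] := exists_near_bipartition e_sym e_irr d0 n0 (ltW hD) hT hn.
have book u v : e u v ->
    \sum_w (e u w && e v w)%:R < alpha * #|'I_n|%:R / 2.
  move=> euv; rewrite -natr_card_pred; apply: le_lt_trans hb.
  rewrite ler_nat.
  exact: (leq_bigmax_cond (P := fun p => e p.1 p.2)
    (F := fun p => book_size e p.1 p.2) (u, v) euv).
have deltaE : 2 * delta = (gamma / 4) ^+ 2 by rewrite /delta; lra.
rewrite deltaE in hS.
have [x] := exists_many_bad_pages e_sym ha1 ha2 g0 g_alpha n0 hD hS opt book.
rewrite hcard => hx; have := lt_le_trans hx (bad_pages_le e_sym e_irr S x).
have := ler_wpM2r n2 g_eps; move: ht; lra.
Qed.
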